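(* Let $\mathcal{P}$ be a PTRS, let $\langle t,\sigma\rangle$ be a pattern term, and let $\mathfrak{T}$ be a $\mathcal{P}$-pattern tree for $\langle t,\sigma\rangle$ with $\operatorname{h}(\mathfrak{T})>0$. If $\sum_{v\text{ leaf of }\mathfrak{T}} p_v\cdot\operatorname{maxOPO}(t,\sigma,t_v)>1$, then $\mathcal{P}$ is not AST. If $\sum_{v\text{ leaf of }\mathfrak{T}} p_v\cdot\operatorname{maxOPO}(t,\sigma,t_v)\ge 1$, then $\mathcal{P}$ is not PAST.
   Context: Terms over a finite signature $\Sigma$ and variables $\mathcal{V}$; substitutions have finite domain and extend homomorphically; $t\sigma\kappa$ means $(t\sigma)\kappa$, and $\sigma\kappa=\kappa\sigma$ means $x\sigma\kappa=x\kappa\sigma$ for all variables $x$; $\sigma^m$ is $m$-fold application. $\operatorname{Pos}(s)$ is the set of positions of $s$, $s|_\pi$ the subterm at $\pi$, $s[r]_\pi$ replacement; $\operatorname{Pos}_\Sigma(t)$ the positions of $t$ carrying function symbols; positions are orthogonal if neither is a prefix of the other. A PTRS is a finite set of rules $\ell\to\{p_1:r_1,\dots,p_k:r_k\}$ ($\ell\notin\mathcal{V}$, $p_j>0$ summing to $1$, variables of each $r_j$ occur in $\ell$), inducing $s\to_{\mathcal{P}}\{p_1:s[r_1\sigma]_\pi,\dots,p_k:s[r_k\sigma]_\pi\}$ whenever $s|_\pi=\ell\sigma$. A $\to_{\mathcal{P}}$-RST is a (possibly infinite) tree whose nodes $v$ are labeled $(p_v:t_v)$ with $p_v\in(0,1]$,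 terms $t_v$, root probability $1$, and each non-leaf node $v$ with children $w_1,\dots,w_k$ satisfying $t_v\to_{\mathcal{P}}\{\tfrac{p_{w_1}}{p_v}:t_{w_1},\dots,\tfrac{p_{w_k}}{p_v}:t_{w_k}\}$; leaves need not be normal forms. $\operatorname{h}(\mathfrak{T})$ is the supremum of node depths. $|\mathfrak{T}|=\sum_{v\text{ leaf}}p_v$; $\operatorname{edl}(\mathfrak{T})=\infty$ if $|\mathfrak{T}|<1$, else $\sum_{v\text{ leaf}}\operatorname{d}(v)p_v$ with $\operatorname{d}$ the depth. $\mathcal{P}$ is AST if $|\mathfrak{T}|=1$ for all $\to_{\mathcal{P}}$-RSTs, and PAST if $\operatorname{edl}(\mathfrak{T})<\infty$ for all of them. A term $u$ occurs in $s$ at $\pi$ if $s|_\pi=u\delta$ for some substitution $\delta$. Positions $\pi_1,\pi_2$ are overlapping w.r.t. $t$ if there is $\tau\in\operatorname{Pos}_\Sigma(t)$ with $\pi_1=\pi_2.\tau$ or $\pi_2=\pi_1.\tau$; $\operatorname{NO}(t,s)$ is the set of all sets $S\subseteq\operatorname{Pos}(s)$ such that $t$ occurs in $s$ at every $\pi\in S$ and distinct positions of $S$ are non-overlapping w.r.t. $t$. A pair $\langle t,\sigma\rangle$ is a pattern term if $t\sigma^m\neq t\sigma^{m'}$ whenever $m\neq m'$. If $t$ occurs in $s$ at $\pi$, then $\langle t,\sigma\rangle$ occurs at $\pi$ with multiplicity $m_\pi$, the maximal $m\in\mathbb{N}$ such that $t\sigma^m$ occurs in $s$ at $\pi$. For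 $S\in\operatorname{NO}(t,s)$ let $m_S=\sum_{\pi\in S}m_\pi$, and $\operatorname{maxOPO}(t,\sigma,s)=\max\{m_S\mid S\in\operatorname{NO}(t,s),\text{ distinct positions of } S \text{ pairwise orthogonal}\}$. A $\to_{\mathcal{P}}$-RST $\mathfrak{T}$ is a $\mathcal{P}$-pattern tree for $\langle t,\sigma\rangle$ if its root term is $t\sigma$, every leaf term $t_v$ contains an occurrence of $t$ at some position, and whenever $t\sigma^q\kappa=t_v|_\pi$ for a leaf $v$, some $q\ge0$, some $\pi\in\operatorname{Pos}(t_v)$ and some substitution $\kappa$, then $\sigma\kappa=\kappa\sigma$. *)

(* Defs.v *)
(* MathComp-Analysis *)
From mathcomp Require Import all_boot all_order all_algebra.
From mathcomp Require Import finmap.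
From mathcomp Require Import all_classical all_reals all_analysis.

Set Implicit Arguments.
Unset Strict Implicit.
Unset Printing Implicit Defensive.

Import Order.TTheory GRing.Theory Num.Theory.
Local Open Scope classical_set_scope.
Local Open Scope ring_scope.

Record signature := Signature { sym :> finType; arity : sym -> nat }.

Inductive term (Sg : signature) (V : Type) : Type :=
| Var (x : V)
| App (f : Sg) (a : 'I_(arity f) -> term Sg V).
Arguments Var {Sg V} x.
Arguments App {Sg V} f a.

(* Argument indices start at 0. *)
Definition pos := seq nat.

(* [subterm s p = Some u] iff p is a position of s and s|_p = u. *)
Fixpoint subterm (Sg : signature) (V : Type) (s : term Sg V) (p : pos) :
    option (term Sg V) :=
  match p, s with
  | [::], _ => Some s
  | _ :: _, Var _ => None
  | i :: p', App f a =>
      match insub i : option 'I_(arity f) with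
      | Some j => subterm (a j) p'
      | None => None
      end
  end.

Definition Pos (Sg : signature) (V : Type) (s : term Sg V) : set pos :=
  [set p | exists u, subterm s p = Some u].

Definition PosF (Sg : signature) (V : Type) (s : term Sg V) : set pos :=
  [set p | exists f a, subterm s p = Some (App f a)].

Definition vars (Sg : signature) (V : Type) (s : term Sg V) : set V :=
  [set x | exists p, subterm s p = Some (Var x)].

(* s[r]_p, meaningful only for p in Pos s. *)
Fixpoint replace (Sg : signature) (V : Type) (s : term Sg V) (p : pos)
    (r : term Sg V) : term Sg V :=
  match p, s with
  | [::], _ => r
  | _ :: _, Var x => Var x
  | i :: p', App f a =>
      App f (fun j => if (j : nat) == i then replace (a j) p' r else a j)
  end.

Definition orthogonal_pos (p1 p2 : pos) : Prop :=
  ~~ prefix p1 p2 /\ ~~ prefix p2 p1.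

Definition domain (Sg : signature) (V : Type) (sigma : V -> term Sg V) : set V :=
  [set x | sigma x <> Var x].

Record substitution (Sg : signature) (V : Type) := Substitution {
  subst_fun :> V -> term Sg V;
  subst_finite : finite_set (domain subst_fun) }.

Fixpoint app (Sg : signature) (V : Type) (sigma : substitution Sg V)
    (t : term Sg V) : term Sg V :=
  match t with
  | Var x => sigma x
  | App f a => App f (fun i => app sigma (a i))
  end.

(* t sigma^m *)
Definition app_iter (Sg : signature) (V : Type) (sigma : substitution Sg V)
    (m : nat) (t : term Sg V) : term Sg V := iter m (app sigma) t.

(* sigma kappa = kappa sigma, in postfix notation for application. *)
Definition subst_commute (Sg : signature) (V : Type)
    (sigma kappa : substitution Sg V) : Prop :=
  forall x : V, app kappa (sigma x) = app sigma (kappa x).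

(* Finite multi-distributions {p_1 : a_1, ..., p_k : a_k}, as families
   over 'I_k; repeated entries are allowed. *)
Record mdistr (R : realType) (A : Type) := MDistr {
  md_size : nat;
  md_prob : 'I_md_size -> R;
  md_val : 'I_md_size -> A }.
Arguments md_prob {R A} m _.
Arguments md_val {R A} m _.

Definition is_mdistr (R : realType) (A : Type) (mu : mdistr R A) : Prop :=
  (forall j, 0 < md_prob mu j) /\ \sum_j md_prob mu j = 1.

Definition md_map (R : realType) (A B : Type) (g : A -> B) (mu : mdistr R A) :
    mdistr R B :=
  MDistr (md_prob mu) (fun j => g (md_val mu j)).

Record rule (R : realType) (Sg : signature) (V : Type) := Rule {
  lhs : term Sg V;
  rhs : mdistr R (term Sg V) }.

Definition is_rule (R : realType) (Sg : signature) (V : Type)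
    (r : rule R Sg V) : Prop :=
  [/\ forall x, lhs r <> Var x,
      is_mdistr (rhs r) &
      forall j, vars (md_val (rhs r) j) `<=` vars (lhs r)].

Record PTRS (R : realType) (Sg : signature) (V : Type) := Ptrs {
  rules : set (rule R Sg V);
  rules_finite : finite_set rules;
  rules_wf : forall r, rules r -> is_rule r }.

Definition step (R : realType) (Sg : signature) (V : Type) (P : PTRS R Sg V)
    (s : term Sg V) (mu : mdistr R (term Sg V)) : Prop :=
  exists (r : rule R Sg V) (p : pos) (sigma : substitution Sg V),
    [/\ rules P r, subterm s p = Some (app sigma (lhs r)) &
        mu = md_map (fun u => replace s p (app sigma u)) (rhs r)].

(* A node is the sequence of child indices leading to it from the root [::],
   so its depth is its size. The labels outside [node] are irrelevant. *)
Record tree (R : realType) (Sg : signature) (V : Type) := Tree {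
  node : set (seq nat);
  nprob : seq nat -> R;
  nterm : seq nat -> term Sg V }.

Definition leaf (R : realType) (Sg : signature) (V : Type) (T : tree R Sg V) :
    set (seq nat) :=
  [set v | node T v /\ forall i, ~ node T (rcons v i)].

Record is_RST (R : realType) (Sg : signature) (V : Type) (P : PTRS R Sg V)
    (T : tree R Sg V) : Prop := IsRST {
  RST_root : node T [::];
  RST_prefix_closed : forall v i, node T (rcons v i) -> node T v;
  RST_prob : forall v, node T v -> 0 < nprob T v <= 1;
  RST_root_prob : nprob T [::] = 1;
  RST_step : forall v, node T v -> ~ leaf T v ->
    exists mu : mdistr R (term Sg V),
      [/\ step P (nterm T v) mu,
          forall i, node T (rcons v i) <-> (i < md_size mu)%N &
          forall j : 'I_(md_size mu),
            nprob T (rcons v j) / nprob T v = md_prob mu j /\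
            nterm T (rcons v j) = md_val mu j] }.

Definition height (R : realType) (Sg : signature) (V : Type)
    (T : tree R Sg V) : \bar R :=
  ereal_sup [set ((size v)%:R)%:E | v in node T].

Definition mass (R : realType) (Sg : signature) (V : Type)
    (T : tree R Sg V) : \bar R :=
  (\esum_(v in leaf T) (nprob T v)%:E)%E.

Definition edl (R : realType) (Sg : signature) (V : Type)
    (T : tree R Sg V) : \bar R :=
  if (mass T < 1%:E)%E then +oo%E
  else (\esum_(v in leaf T) ((size v)%:R * nprob T v)%:E)%E.

Definition AST (R : realType) (Sg : signature) (V : Type)
    (P : PTRS R Sg V) : Prop :=
  forall T : tree R Sg V, is_RST P T -> mass T = 1%:E.

Definition PAST (R : realType) (Sg : signature) (V : Type)
    (P : PTRS R Sg V) : Prop :=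
  forall T : tree R Sg V, is_RST P T -> (edl T < +oo)%E.

Definition occurs (Sg : signature) (V : Type) (u s : term Sg V) (p : pos) :
    Prop :=
  exists delta : substitution Sg V, subterm s p = Some (app delta u).

Definition overlapping (Sg : signature) (V : Type) (t : term Sg V)
    (p1 p2 : pos) : Prop :=
  exists2 tau, PosF t tau & p1 = p2 ++ tau \/ p2 = p1 ++ tau.

Definition NO (Sg : signature) (V : Type) (t s : term Sg V) :
    set {fset pos} :=
  [set S : {fset pos} |
    [/\ forall p, p \in S -> Pos s p,
        forall p, p \in S -> occurs t s p &
        forall p1 p2, p1 \in S -> p2 \in S -> p1 <> p2 ->
          ~ overlapping t p1 p2]].

Definition pattern_term (Sg : signature) (V : Type) (t : term Sg V)
    (sigma : substitution Sg V) : Prop :=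
  forall m m' : nat, m <> m' -> app_iter sigma m t <> app_iter sigma m' t.

(* The maximum of A; the default value 0 is used only if there is none. *)
Definition nat_max (A : set nat) : nat :=
  xget 0%N [set m | A m /\ forall n, A n -> (n <= m)%N].

(* The maximum exists if (t, sigma) is a pattern term occurring in s at p:
   as sigma has a finite domain, the sizes of the terms t sigma^m are
   unbounded. *)
Definition multiplicity (Sg : signature) (V : Type) (t : term Sg V)
    (sigma : substitution Sg V) (s : term Sg V) (p : pos) : nat :=
  nat_max [set m | occurs (app_iter sigma m t) s p].

Definition set_multiplicity (Sg : signature) (V : Type) (t : term Sg V)
    (sigma : substitution Sg V) (s : term Sg V) (S : {fset pos}) : nat :=
  (\sum_(p <- S) multiplicity t sigma s p)%N.

Definition maxOPO (Sg : signature) (V : Type) (t : term Sg V)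
    (sigma : substitution Sg V) (s : term Sg V) : nat :=
  nat_max [set set_multiplicity t sigma s S | S in
    [set S : {fset pos} | NO t s S /\
      forall p1 p2, p1 \in S -> p2 \in S -> p1 <> p2 -> orthogonal_pos p1 p2]].

(* In [PT_commute], kappa is the matcher: its domain is included in the
   variables of t sigma^q. If kappa could take arbitrary values on the other
   variables, then mapping a fresh y to some x with x sigma <> x would break
   commutation, so for infinite V no tree with a leaf would be a pattern tree.
   The restriction only weakens the condition. *)
Record is_pattern_tree (R : realType) (Sg : signature) (V : Type)
    (P : PTRS R Sg V) (t : term Sg V) (sigma : substitution Sg V)
    (T : tree R Sg V) : Prop := IsPatternTree {
  PT_RST : is_RST P T;
  PT_root : nterm T [::] = app sigma t;
  PT_leaf : forall v, leaf T v -> exists p, occurs t (nterm T v) p;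
  PT_commute : forall (v : seq nat) (q : nat) (p : pos)
      (kappa : substitution Sg V),
    leaf T v ->
    domain kappa `<=` vars (app_iter sigma q t) ->
    subterm (nterm T v) p = Some (app kappa (app_iter sigma q t)) ->
    subst_commute sigma kappa }.

(* Main.v *)
(* A term "with counter n" contains pairwise orthogonal instances
   t sigma^m kappa, with kappa commuting with sigma, whose exponents m sum to n.
   If n > 0, choose such an instance with m > 0. It is (t sigma) sigma^(m-1) kappa,
   so the pattern tree can be unfolded there; since sigma commutes with the
   matchers, reaching the leaf v leads to a counter of at least
   n - 1 + maxOPO(t_v). Restarting the pattern tree as long as the counter is
   positive gives an RST, a random walk, whose leaves have counter 0.

   Let f(z) be the sum of p_v z^maxOPO(t_v) over the leaves v. If c is smaller
   than the sum of p_v maxOPO(t_v), then f(z) <= 1 - (1 - z) c for some z < 1.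
   For c = 1, z^counter is a supermartingale, so the walk, which starts with
   counter 1, terminates with probability at most z. For c = 1 - d, we get
   f(z) <= z + (1 - z) d, so z^counter grows by at most (1 - z) d per step. If
   the walk terminated almost surely with expected derivation length B, this
   would give 1 <= z + (1 - z) d (1 + B), which is false for small d. *)
Require Import Defs.
From mathcomp Require Import all_boot all_order all_algebra.
From mathcomp Require Import finmap.
From mathcomp Require Import all_classical all_reals all_analysis.
From mathcomp Require Import ring lra zify.

Set Implicit Arguments.
Unset Strict Implicit.
Unset Printing Implicit Defensive.

Import Order.TTheory GRing.Theory Num.Theory.
Local Open Scope classical_set_scope.
Local Open Scope ring_scope.

(** * Terms and substitutions *)

Section Terms.
Variables (Sg : signature) (V : Type).
Implicit Types (s u r : term Sg V) (p q : pos) (sigma kappa : substitution Sg V).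

Lemma subterm_nil s : subterm s [::] = Some s.
Proof. by case: s. Qed.

Lemma replace_nil s r : replace s [::] r = r.
Proof. by case: s. Qed.

Lemma subterm_cat s p q u : subterm s p = Some u ->
  subterm s (p ++ q) = subterm u q.
Proof.
elim: p s => [|i p IH] [x|f a] //=; rewrite ?subterm_nil ?replace_nil//; try by case=> <-.
by case: (@insubP _ _ 'I_(arity f) i) => // j _ _; exact: IH.
Qed.

Lemma subterm_app s p u sigma : subterm s p = Some u ->
  subterm (app sigma s) p = Some (app sigma u).
Proof.
elim: p s => [|i p IH] [x|f a] //=; rewrite ?subterm_nil ?replace_nil//; try by case=> <-.
by case: (@insubP _ _ 'I_(arity f) i) => // j _ _; exact: IH.
Qed.

Lemma subterm_app_iter s p u sigma m : subterm s p = Some u ->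
  subterm (app_iter sigma m s) p = Some (app_iter sigma m u).
Proof. by move=> sp; elim: m => //= m; exact: subterm_app. Qed.

Lemma subterm_replace s p u r : subterm s p = Some u ->
  subterm (replace s p r) p = Some r.
Proof.
elim: p s => [|i p IH] [x|f a] //=; rewrite ?subterm_nil//.
by case: (@insubP _ _ 'I_(arity f) i) => // j _ <-; rewrite eqxx; exact: IH.
Qed.

Lemma replace_app s p u r sigma : subterm s p = Some u ->
  app sigma (replace s p r) = replace (app sigma s) p (app sigma r).
Proof.
elim: p s => [|i p IH] [x|f a] //=; rewrite ?replace_nil//.
case: (@insubP _ _ 'I_(arity f) i) => // j _ ji ap; congr App; apply/funext => k.
case: eqP => // ki; apply: IH; rewrite (_ : k = j) //.
by apply: val_inj; rewrite /= ki ji.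
Qed.

Lemma replace_cat s p q u r : subterm s p = Some u ->
  replace s (p ++ q) r = replace s p (replace u q r).
Proof.
elim: p s => [|i p IH] [x|f a] //=; rewrite ?subterm_nil ?replace_nil//; try by case=> <-.
case: (@insubP _ _ 'I_(arity f) i) => // j _ ji ap; congr App; apply/funext => k.
case: eqP => // ki; apply: IH; rewrite (_ : k = j) //.
by apply: val_inj; rewrite /= ki ji.
Qed.

Definition orth p q := ~~ prefix p q && ~~ prefix q p.

Lemma orth_sym : symmetric orth.
Proof. by move=> p q; rewrite /orth andbC. Qed.

(** Two prefixes of one word are comparable, so a prefix [p] of [q1 ++ q2] would be comparable with
    [q1]. *)
Lemma orth_catr p q1 q2 : orth p q1 -> orth p (q1 ++ q2).
Proof.
move=> /andP[pq qp]; apply/andP; split; last first.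
  by apply: contra qp => /catl_prefix.
apply/negP => /prefixP[r] e; move: pq qp; rewrite !prefixE.
have [le|/ltnW le] := leqP (size p) (size q1).
  by rewrite -(takel_cat q2 le) e take_size_cat// eqxx.
by rewrite -(takel_cat r le) -e take_size_cat// eqxx.
Qed.

Lemma orth_cat2l p q1 q2 : orth (p ++ q1) (p ++ q2) = orth q1 q2.
Proof. by rewrite /orth !prefix_catr// eqxx. Qed.

Lemma subterm_replace_orth s p q r : orth p q ->
  subterm (replace s p r) q = subterm s q.
Proof.
elim: p s q => [|i p IH] [x|f a] [|j q] //=.
rewrite /orth !prefix_cons eq_sym.
case: (@insubP _ _ 'I_(arity f) j) => // k _ kj; rewrite kj.
by case: eqP => //= _ pq; exact: IH.
Qed.

Lemma domain_comp sigma kappa :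
  finite_set (domain (fun x => app kappa (sigma x))).
Proof.
apply: (@sub_finite_set _ _ (domain sigma `|` domain kappa)).
  move=> x; rewrite /domain /= => h.
  have [sx|] := pselect (sigma x = Var x); last by left.
  by right; move: h; rewrite sx.
by rewrite finite_setU; split; exact: subst_finite.
Qed.

Definition subst_comp sigma kappa := Substitution (domain_comp sigma kappa).

Lemma app_comp sigma kappa s :
  app (subst_comp sigma kappa) s = app kappa (app sigma s).
Proof. by elim: s => //= f a IH; congr App; apply/funext => i; exact: IH. Qed.

Lemma eq_app sigma kappa s : (forall x, vars s x -> sigma x = kappa x) ->
  app sigma s = app kappa s.
Proof.
elim: s => [x|f a IH] /= h; first by apply: h; exists [::]; rewrite subterm_nil.
congr App; apply/funext => i; apply: IH => x [p xp]; apply: h.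
exists ((i : nat) :: p) => /=.
by case: (@insubP _ _ 'I_(arity f) i) => [j _ /val_inj ->//|]; rewrite ltn_ord.
Qed.

Lemma subst_id_finite : finite_set (domain (@Var Sg V)).
Proof. by rewrite (_ : domain _ = set0) //; apply/seteqP; split. Qed.

Definition subst_id := Substitution subst_id_finite.

Lemma app_id s : app subst_id s = s.
Proof. by elim: s => //= f a IH; congr App; apply/funext => i; exact: IH. Qed.

Lemma subst_id_commute sigma : subst_commute sigma subst_id.
Proof. by move=> x; rewrite app_id. Qed.

Lemma commute_app sigma kappa s : subst_commute sigma kappa ->
  app kappa (app sigma s) = app sigma (app kappa s).
Proof.
by move=> c; elim: s => //= f a IH; congr App; apply/funext => i; exact: IH.
Qed.

Lemma commute_app_iter sigma kappa m s : subst_commute sigma kappa ->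
  app kappa (app_iter sigma m s) = app_iter sigma m (app kappa s).
Proof. by move=> c; elim: m => //= m <-; exact: commute_app. Qed.

Lemma subst_commute_comp sigma k1 k2 : subst_commute sigma k1 ->
  subst_commute sigma k2 -> subst_commute sigma (subst_comp k1 k2).
Proof. by move=> c1 c2 x; rewrite app_comp c1 commute_app. Qed.

Lemma domain_restrict (A : set V) sigma :
  finite_set (domain (fun x => if asbool (A x) then sigma x else Var x)).
Proof.
apply: sub_finite_set (subst_finite sigma) => x.
by rewrite /domain /=; case: asboolP.
Qed.

(** Cuts a matcher down to the variables of the matched term, since [PT_commute] speaks only of such
    matchers. *)
Definition subst_restrict A sigma := Substitution (domain_restrict A sigma).

Lemma app_restrict sigma s : app (subst_restrict (vars s) sigma) s = app sigma s.
Proof. by apply: eq_app => x xs /=; case: asboolP. Qed.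

Lemma domain_restrict_sub A sigma : domain (subst_restrict A sigma) `<=` A.
Proof. by move=> x; rewrite /domain /=; case: asboolP. Qed.

End Terms.

(** * Closure of rewrite steps under substitutions and contexts *)

Section Steps.
Variables (R : realType) (Sg : signature) (V : Type) (P : PTRS R Sg V).
Implicit Types (s u : term Sg V) (mu : mdistr R (term Sg V)).

Lemma step_app u mu (sigma : substitution Sg V) : step P u mu ->
  step P (app sigma u) (md_map (app sigma) mu).
Proof.
move=> [r [p [tau [Pr up ->]]]]; exists r, p, (subst_comp tau sigma); split=> //.
  by rewrite app_comp; exact: subterm_app.
rewrite /md_map; congr MDistr; apply/funext => j /=.
by rewrite app_comp; exact: replace_app up.
Qed.

Lemma step_app_iter u mu (sigma : substitution Sg V) m : step P u mu ->
  step P (app_iter sigma m u) (md_map (app_iter sigma m) mu).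
Proof.
elim: m => [|m IH] h /=; last exact: (step_app _ (IH h)).
by case: mu h.
Qed.

Lemma step_replace s p u mu : subterm s p = Some u -> step P u mu ->
  step P s (md_map (replace s p) mu).
Proof.
move=> sp [r [q [tau [Pr uq ->]]]]; exists r, (p ++ q), tau; split=> //.
  by rewrite (subterm_cat _ sp).
rewrite /md_map; congr MDistr; apply/funext => j /=.
by rewrite (replace_cat _ _ sp).
Qed.

Lemma step_mdistr s mu : step P s mu -> is_mdistr mu.
Proof. by move=> [r [p [tau [/rules_wf[_ ? _] _ ->]]]]. Qed.

Lemma is_mdistr_le1 A (nu : mdistr R A) j : is_mdistr nu -> md_prob nu j <= 1.
Proof.
move=> [p0 <-]; rewrite (bigD1 j)//= lerDl sumr_ge0// => i _; exact: ltW.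
Qed.

End Steps.

(** * Pumping the pattern term *)

Section Pumping.
Variables (Sg : signature) (V : Type).
Variables (t : term Sg V) (sigma : substitution Sg V).
Implicit Types (s u : term Sg V) (p q : pos) (kappa : substitution Sg V).

Definition pumped s (a : pos * nat) : Prop :=
  exists2 kappa, subst_commute sigma kappa &
    subterm s a.1 = Some (app kappa (app_iter sigma a.2 t)).

Definition orthogonal_family (l : seq (pos * nat)) : bool :=
  pairwise (fun a b => orth a.1 b.1) l.

Definition counter s n : Prop := exists l,
  [/\ orthogonal_family l, forall a, a \in l -> pumped s a &
      (\sum_(a <- l) a.2)%N = n].

(* A pattern tree is being unfolded inside s, and u is the label of its current
   node; n counts what is left once the unfolded copy of sigma is used up. *)
Definition unfolding s u n : Prop := exists p m kappa l,
  [/\ subst_commute sigma kappa,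
      subterm s p = Some (app kappa (app_iter sigma m u)),
      orthogonal_family l,
      forall a, a \in l -> orth p a.1 /\ pumped s a &
      (\sum_(a <- l) a.2 + m)%N = n].

Lemma unfolding_self u : unfolding u u 0.
Proof.
exists [::], 0, (@subst_id Sg V), [::]; split=> //.
- exact: subst_id_commute.
- by rewrite subterm_nil app_id.
- by rewrite big_nil.
Qed.

Lemma counter_unfolding s n : counter s n.+1 -> unfolding s (app sigma t) n.
Proof.
move=> [l [hl pl sl]].
have /hasP[a al a0] : has (fun a => 0 < a.2)%N l.
  apply: contraTT isT => /hasPn h; move: sl; rewrite big_seq big1 // => a al.
  by apply/eqP; rewrite -leqn0 leqNgt h.
move: hl pl sl; case/splitPr: al => l1 l2.
rewrite /orthogonal_family pairwise_cat pairwise_cons allrel_consr.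
move=> /and3P[] /andP[ha h12] ol1 /andP[hb ol2] pl.
rewrite big_cat big_cons /= => sl.
have [kappa c sa] : pumped s a by apply: pl; rewrite mem_cat mem_head orbT.
exists a.1, a.2.-1, kappa, (l1 ++ l2); split=> //.
- by rewrite sa /app_iter -iterSr prednK.
- by rewrite /orthogonal_family pairwise_cat h12 ol1.
- move=> b; rewrite mem_cat => /orP[b1|b2]; split.
  + by rewrite orth_sym; exact: (allP ha).
  + by apply: pl; rewrite mem_cat b1.
  + exact: (allP hb).
  + by apply: pl; rewrite mem_cat inE b2 !orbT.
- by rewrite big_cat /=; case: (a.2) a0 sl => // m _ /=; lia.
Qed.

(** The exponent [m] waiting at [p] is inherited by every instance found inside [u]. As [l] is
    non-empty, [m] survives at least once; several instances multiply it, whence an inequality. *)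
Lemma unfolding_counter s u n (l : seq (pos * nat)) :
  unfolding s u n -> l != [::] -> orthogonal_family l ->
  (forall a, a \in l -> pumped u a) ->
  exists2 k, (n + \sum_(a <- l) a.2 <= k)%N & counter s k.
Proof.
move=> [p [m [kappa [l0 [c sp ol0 pl0 sl0]]]]] l_neq0 ol pl.
pose l1 := [seq (p ++ a.1, a.2 + m)%N | a <- l].
exists (\sum_(a <- l0 ++ l1) a.2)%N.
  rewrite big_cat /= big_map big_split /= -sl0.
  case: l l_neq0 {ol pl l1} => // a l _; rewrite !big_cons.
  by rewrite -!addnA leq_add2l; lia.
exists (l0 ++ l1); split=> //.
- rewrite /orthogonal_family in ol0 *; rewrite pairwise_cat ol0 /l1 pairwise_map /=.
  apply/andP; split.
    apply/allrelP => a b al0 /mapP[b' _ ->] /=.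
    by apply: orth_catr; rewrite orth_sym; have [] := pl0 _ al0.
  by apply: sub_pairwise ol => a b /=; rewrite orth_cat2l.
- move=> a; rewrite mem_cat => /orP[/pl0[]//|/mapP[b bl ->{a}]].
  (* Commutation turns [t sigma^b kb sigma^m kappa] into [t sigma^(b+m) kb kappa]. *)
  have [kb cb ub] := pl _ bl.
  exists (subst_comp kb kappa); first exact: subst_commute_comp.
  rewrite /= (subterm_cat _ sp) (subterm_app _ (subterm_app_iter _ _ ub)).
  by rewrite app_comp -commute_app_iter// /app_iter addnC iterD.
Qed.

(** The step of [u] is lifted through [sigma^m], [kappa] and the context of [p]. Subterms at
    positions orthogonal to [p] are untouched, so every outcome keeps the count [n]. *)
Lemma unfolding_step (R : realType) (P : PTRS R Sg V) s u n mu :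
  unfolding s u n -> step P u mu ->
  exists2 f : term Sg V -> term Sg V, step P s (md_map f mu) &
    forall u', unfolding (f u') u' n.
Proof.
move=> [p [m [kappa [l [c sp ol pl sl]]]]] umu.
exists (fun u' => replace s p (app kappa (app_iter sigma m u'))).
  have := step_app kappa (step_app_iter sigma m umu).
  by move/(step_replace sp).
move=> u'; exists p, m, kappa, l; split=> //.
  exact: subterm_replace sp.
move=> a /pl[pa [ka ca sa]]; split=> //.
by exists ka => //; rewrite subterm_replace_orth.
Qed.

Lemma uniq_pairwise (T : eqType) (r : rel T) (l : seq T) : uniq l ->
  {in l &, forall x y, x != y -> r x y} -> pairwise r l.
Proof.
elim: l => //= x l IH /andP[xl ul] h; apply/andP; split.
  apply/allP => y yl; apply: h; rewrite ?mem_head ?inE ?yl ?orbT//.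
  by apply: contraNneq xl => ->.
by apply: IH => // y z yl zl; apply: h; rewrite inE ?yl ?zl orbT.
Qed.

(** The premise [Q 0] covers the default value of [nat_max]. *)
Lemma nat_max_ind (Q : nat -> Prop) (A : set nat) :
  Q 0 -> (forall n, A n -> Q n) -> Q (nat_max A).
Proof. by move=> Q0 QA; rewrite /nat_max; case: xgetP => // n _ [/QA]. Qed.

Lemma maxOPO_family s : (exists p, occurs t s p) ->
  (forall p m kappa, domain kappa `<=` vars (app_iter sigma m t) ->
    subterm s p = Some (app kappa (app_iter sigma m t)) ->
    subst_commute sigma kappa) ->
  exists l, [/\ l != [::], orthogonal_family l,
    forall a, a \in l -> pumped s a & (\sum_(a <- l) a.2)%N = maxOPO t sigma s].
Proof.
move=> [p0 tp0] h.
have pumpedP p m : occurs (app_iter sigma m t) s p -> pumped s (p, m).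
  move=> [k sp]; rewrite -app_restrict in sp.
  by exists (subst_restrict (vars (app_iter sigma m t)) k) => //; apply: h sp;
    exact: domain_restrict_sub.
(* The value 0 may come from the default or from an empty set; a singleton with exponent 0 keeps the
   family non-empty, as [unfolding_counter] demands. *)
have zero : exists l, [/\ l != [::], orthogonal_family l,
    forall a, a \in l -> pumped s a & (\sum_(a <- l) a.2)%N = 0].
  exists [:: (p0, 0)]; split=> //; last by rewrite big_seq1.
  by move=> a; rewrite inE => /eqP ->; exact: pumpedP.
rewrite /maxOPO; elim/nat_max_ind: (nat_max _) => // n /= [S [noS oS] <-].
have [->//|Sn0] := eqVneq (set_multiplicity t sigma s S) 0.
exists [seq (p, multiplicity t sigma s p) | p <- S]; split.
- apply: contra Sn0 => /eqP e; rewrite /set_multiplicity.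
  by move: e; case: (enum_fset S) => // _; rewrite big_nil.
- rewrite /orthogonal_family pairwise_map; apply: uniq_pairwise.
    exact: fset_uniq.
  by move=> p q pS qS /eqP pq; apply/andP; exact: oS.
- move=> a /mapP[p pS ->]; apply: pumpedP; have [_ occS _] := noS.
  rewrite /multiplicity; elim/nat_max_ind: (nat_max _) => //.
  exact: occS.
- by rewrite big_map.
Qed.

End Pumping.

(** * Sums over the leaves of a rewrite sequence tree *)

Section LeafSums.
Variables (R : realType) (Sg : signature) (V : Type) (P : PTRS R Sg V).
Variable (T : tree R Sg V).
Hypothesis RST_T : is_RST P T.
Implicit Types (v w : seq nat) (g h psi : seq nat -> R).

Lemma node_catl v w : node T (v ++ w) -> node T v.
Proof.
elim/last_ind: w => [|w i IH]; first by rewrite cats0.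
by rewrite -rcons_cat => /(RST_prefix_closed RST_T).
Qed.

Lemma nprob_gt0 v : node T v -> 0 < nprob T v.
Proof. by move=> /(RST_prob RST_T)/andP[]. Qed.

Lemma RST_children v : node T v -> ~ leaf T v -> exists k,
  (forall i, node T (rcons v i) <-> (i < k)%N) /\
  \sum_(i < k) nprob T (rcons v i) = nprob T v.
Proof.
move=> nv lv; have [mu [/step_mdistr[_ mu1] ch pr]] := RST_step RST_T nv lv.
exists (md_size mu); split=> //.
rewrite -[RHS]mulr1 -mu1 mulr_sumr; apply: eq_bigr => j _.
by have [<- _] := pr j; rewrite mulrC divfK// gt_eqF// nprob_gt0.
Qed.

Lemma sum_children v k : node T v -> ~ leaf T v ->
  (forall i, node T (rcons v i) <-> (i < k)%N) ->
  \sum_(i < k) nprob T (rcons v i) = nprob T v.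
Proof.
move=> nv lv ch; have [k' [ch' <-]] := RST_children nv lv.
have le i : (i < k)%N <-> (i < k')%N.
  by split=> [/(ch i).2/(ch' i).1|/(ch' i).2/(ch i).1].
by case: (ltngtP k k') => [/(le k).2|/(le k').1|->//]; rewrite ltnn.
Qed.

Lemma leaf_prefix v w : leaf T v -> leaf T w -> prefix v w -> w = v.
Proof.
move=> [_ lv] [nw _] /prefixP[[|i w'] e]; first by rewrite e cats0.
case: (lv i); apply: (@node_catl _ w'); by rewrite cat_rcons -e.
Qed.

(** The index set is [leaf T] for every [v], with weight 0 outside the subtree of [v], so that leaf
    sums at different nodes compare termwise. *)
Definition leafsum g v : \bar R :=
  (\esum_(w in leaf T) (if prefix v w then g w else 0)%:E)%E.

Lemma leafsum_root g : leafsum g [::] = (\esum_(w in leaf T) (g w)%:E)%E.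
Proof. by apply: eq_esum => w _; rewrite prefix0s. Qed.

Lemma leafsum_leaf g v : leaf T v -> 0 <= g v -> leafsum g v = (g v)%:E.
Proof.
move=> lv gv.
rewrite /leafsum [LHS](_ : _ = (\esum_(w in leaf T `&` [set v]) (g w)%:E)%E).
  rewrite (_ : _ `&` _ = [set v]) ?esum_set1 ?lee_fin//.
  by apply/seteqP; split=> [w []//|w ->].
rewrite [RHS]esum_mkcondr; apply: eq_esum => w lw.
case: ifPn => [/(leaf_prefix lv lw) ->|pw]; first by rewrite mem_set.
by rewrite memNset// => e; move: pw; rewrite e prefix_refl.
Qed.

Lemma leafsum_children g v k : node T v -> ~ leaf T v ->
  (forall i, node T (rcons v i) <-> (i < k)%N) ->
  (forall w, leaf T w -> 0 <= g w) ->
  (leafsum g v = \sum_(i < k) leafsum g (rcons v i))%E.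
Proof.
move=> nv lv ch g0; rewrite /leafsum -esum_sum; last first.
  by move=> w j lw _; case: ifP => // _; rewrite lee_fin g0.
apply: eq_esum => w lw; case: ifPn => [/prefixP[[|i w'] e]|pw].
- by exfalso; apply: lv; rewrite cats0 in e; rewrite -e.
- have ik : (i < k)%N.
    apply/ch/(@node_catl _ w'); rewrite cat_rcons -e; exact: lw.1.
  rewrite (bigD1 (Ordinal ik))//= [X in (_ + X)%E]big1.
    by rewrite adde0 e -cat_rcons prefix_prefix.
  move=> j ji; case: ifPn => // /prefixP[w'' e'].
  move: e'; rewrite e cat_rcons => /eqP; rewrite eqseq_cat// eqxx /=.
  by case/eqP => ij; move: ji; rewrite -val_eqE /= ij eqxx.
- rewrite big1// => j _; case: ifPn => // pj.
  by case/negP: pw; apply: prefix_trans pj; exact: prefix_rcons.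
Qed.

Lemma leafsum_ge0 g v : (forall w, leaf T w -> 0 <= g w) -> (0 <= leafsum g v)%E.
Proof. by move=> g0; apply: esum_ge0 => w lw; case: ifP => _ //; rewrite lee_fin g0. Qed.

Lemma le_leafsum g h v : (forall w, leaf T w -> prefix v w -> g w <= h w) ->
  (leafsum g v <= leafsum h v)%E.
Proof. by move=> gh; apply: le_esum => w lw; case: ifPn => // pw; rewrite lee_fin gh. Qed.

Definition superharmonic psi := forall v k, node T v -> ~ leaf T v ->
  (forall i, node T (rcons v i) <-> (i < k)%N) ->
  \sum_(i < k) psi (rcons v i) <= psi v.

(** A supermartingale bound. With the leaves deeper than [N] ignored, it follows by induction from
    depth [N] up to [v]; every finite set of leaves fits under some [N]. *)
Lemma leafsum_le psi g : superharmonic psi ->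
  (forall v, node T v -> 0 <= psi v) ->
  (forall w, leaf T w -> 0 <= g w) -> (forall w, leaf T w -> g w <= psi w) ->
  forall v, node T v -> (leafsum g v <= (psi v)%:E)%E.
Proof.
move=> sh psi0 g0 gpsi.
pose gN N w := if (size w <= N)%N then g w else 0.
have gN0 N w : leaf T w -> 0 <= gN N w by rewrite /gN; case: ifP => // _; exact: g0.
have H N n : forall v, node T v -> (N < size v + n)%N ->
    (leafsum (gN N) v <= (psi v)%:E)%E.
  elim: n => [|n IH] v nv; rewrite ?addn0 ?addnS => Nv.
    rewrite /leafsum esum1 ?lee_fin ?psi0// => w lw; case: ifPn => // /size_prefix vw.
    by rewrite /gN leqNgt (leq_trans Nv).
  have [lv|lv] := pselect (leaf T v).
    rewrite leafsum_leaf ?gN0// lee_fin /gN; case: ifP => _; first exact: gpsi.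
    exact: psi0.
  have [k [ch _]] := RST_children nv lv.
  rewrite (leafsum_children nv lv ch (gN0 N)).
  apply: le_trans (_ : _ <= \sum_(i < k) (psi (rcons v i))%:E)%E _.
    by apply: lee_sum => i _; apply: IH; [apply/ch|rewrite size_rcons].
  by rewrite sumEFin lee_fin; apply: sh ch.
move=> v nv; apply: ge_ereal_sup => _ [F [finF FT] <-].
pose N := (\max_(w <- fset_set F) size w)%N.
apply: le_trans (H N N.+1 v nv _); last by rewrite addnS ltnS leq_addl.
apply: esum_ge; exists F; first by [].
rewrite !fsbig_finite//= big_seq [leRHS]big_seq; apply: lee_sum => w wF.
have wN : (size w <= N)%N by exact: (@leq_bigmax_seq _ _ xpredT size w wF).
by rewrite /gN wN.
Qed.

Lemma leafsum_nprob_le v : node T v -> (leafsum (nprob T) v <= (nprob T v)%:E)%E.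
Proof.
apply: leafsum_le.
- by move=> {}v k nv lv ch; rewrite sum_children.
- by move=> w /nprob_gt0/ltW.
- by move=> w [/nprob_gt0/ltW].
- by [].
Qed.

Lemma mass_le1 : (mass T <= 1)%E.
Proof.
rewrite /mass -leafsum_root -(RST_root_prob RST_T).
exact: leafsum_nprob_le (RST_root RST_T).
Qed.

(* A deficit at v would be a deficit at the root. *)
Lemma leafsum_nprob : (1 <= mass T)%E ->
  forall v, node T v -> leafsum (nprob T) v = (nprob T v)%:E.
Proof.
move=> m1; elim/last_ind => [|v i IH] ni.
  apply/eqP; rewrite eq_le leafsum_nprob_le//= leafsum_root.
  by rewrite (RST_root_prob RST_T).
have nv := RST_prefix_closed RST_T ni.
have lv : ~ leaf T v by case=> _ /(_ i).
have [k [ch sumk]] := RST_children nv lv.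
have ge0 w : leaf T w -> 0 <= nprob T w by move=> [/nprob_gt0/ltW].
have := IH nv; rewrite (leafsum_children nv lv ch ge0) -sumk -sumEFin.
have le j : j \in 'I_k -> (leafsum (nprob T) (rcons v (j : 'I_k)) <=
    (nprob T (rcons v j))%:E)%E by move=> _; apply: leafsum_nprob_le; apply/ch.
have ik : (i < k)%N by apply/ch.
rewrite (bigD1 (Ordinal ik))//= [RHS](bigD1 (Ordinal ik))//= => e.
apply/eqP; rewrite eq_le leafsum_nprob_le//=.
set b := (\sum_(j < k | _) leafsum _ _)%E in e.
set c := (\sum_(j < k | _) _%:E)%E in e.
have bc : (b <= c)%E by apply: lee_sum => j _; exact: le.
have cfin : c \is a fin_num by rewrite /c sumEFin.
have := leeD2l (leafsum (nprob T) (rcons v i)) bc.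
by rewrite e leeD2rE.
Qed.

End LeafSums.

(** * The generating function of the leaf weights near 1 *)

Section GeneratingFunction.
Variable R : realType.

Lemma bernoulli_ge (e : R) n : 0 <= e <= 1 -> 1 - n%:R * e <= (1 - e) ^+ n.
Proof.
move=> /andP[e0 e1]; elim: n => [|n IH]; first by rewrite mul0r subr0 expr0.
have n0 : 0 <= n%:R :> R by [].
rewrite exprS -natr1; apply: le_trans (_ : (1 - e) * (1 - n%:R * e) <= _).
  by nra.
by apply: ler_wpM2l => //; lra.
Qed.

(** [1 - z ^+ n] is the sum of the [n] terms [(1 - z) * z ^+ i] with [i < n], each at least
    [(1 - z) * z ^+ k]. *)
Lemma expr_tangent_le (z : R) n k : 0 <= z <= 1 -> (n <= k)%N ->
  z ^+ n + (1 - z) * z ^+ k * n%:R <= 1.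
Proof.
move=> /andP[z0 z1]; elim: n => [|n IH] nk; first by rewrite expr0 mulr0 addr0.
have {}IH := IH (ltnW nk).
have zk : z ^+ k <= z ^+ n by apply: ler_wiXn2l => //; exact: ltnW.
rewrite exprS -natr1; nra.
Qed.

(** A finite set [F] of leaves already has a sum [c'] above [c]. On [F], where [X] is at most [K],
    [expr_tangent_le] applies; elsewhere [z ^+ X w <= 1] suffices. For [z] close to 1, [z ^+ K * c']
    is still at least [c]. *)
Lemma generating_function_le (Sg : signature) (V : Type) (P : PTRS R Sg V)
    (T : tree R Sg V) (X : seq nat -> nat) (c : R) : is_RST P T -> 0 <= c ->
  (c%:E < \esum_(w in leaf T) (nprob T w * (X w)%:R)%:E)%E ->
  exists z : R, [/\ 0 < z, z < 1 &
    (\esum_(w in leaf T) (nprob T w * z ^+ X w)%:E <= (1 - (1 - z) * c)%:E)%E].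
Proof.
move=> RST_T c0 /ereal_sup_gt[_ [F [finF FT] <-]].
rewrite fsbig_finite//= sumEFin lte_fin; set c' := (\sum_(w <- _) _) => cc'.
have p0 w : leaf T w -> 0 <= nprob T w by move=> [/(nprob_gt0 RST_T)/ltW].
pose K := (\max_(w <- fset_set F) X w)%N.
have XK w : w \in fset_set F -> (X w <= K)%N.
  by move=> wF; exact: (@leq_bigmax_seq _ _ xpredT X w wF).
(* Chosen so that [K * e * c' <= c' - c], whence [(1 - e) ^+ K * c' >= c] by Bernoulli's inequality.
   Adding 1 to [K] and [c'] keeps the denominator positive and [e] below 1. *)
pose e := (c' - c) / (K.+1%:R * (c' + 1)).
have D0 : 0 < K.+1%:R * (c' + 1) by apply: mulr_gt0 => //; lra.
have e0 : 0 < e by apply: divr_gt0 => //; lra.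
have K1 : 1 <= K.+1%:R :> R by rewrite ler1n.
have e1 : e < 1 by rewrite ltr_pdivrMr// mul1r; nra.
have eK : K%:R * e * c' <= c' - c.
  have : e * (K.+1%:R * (c' + 1)) = c' - c by rewrite divfK// gt_eqF.
  have : 0 <= K%:R :> R by [].
  by rewrite -natr1; nra.
exists (1 - e); split; [lra|lra|].
set z := 1 - e.
have z01 : 0 <= z <= 1 by rewrite /z; lra.
have zK : c <= z ^+ K * c'.
  have : 1 - K%:R * e <= z ^+ K by apply: bernoulli_ge; lra.
  nra.
pose h w := if w \in F then nprob T w * ((1 - z) * z ^+ K * (X w)%:R) else 0.
have h0 w : leaf T w -> 0 <= h w.
  move=> lw; rewrite /h; case: ifP => // _.
  by rewrite !mulr_ge0 ?p0 ?exprn_ge0//; lra.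
have Sh : ((1 - z)%:E * c%:E <= \esum_(w in leaf T) (h w)%:E)%E.
  apply: esum_ge; exists F => //; rewrite fsbig_finite//= sumEFin lee_fin.
  rewrite (_ : \sum_(w <- _) _ = (1 - z) * (z ^+ K * c')); first by nra.
  rewrite /c' !mulr_sumr [LHS]big_seq [RHS]big_seq; apply: eq_bigr => w wF.
  by rewrite /h -(in_fset_set finF) wF; ring.
have Sgh : (\esum_(w in leaf T) (nprob T w * z ^+ X w)%:E +
    \esum_(w in leaf T) (h w)%:E <= 1)%E.
  rewrite -esumD; last 2 first.
  - by move=> w lw; rewrite lee_fin mulr_ge0 ?p0// exprn_ge0//; lra.
  - by move=> w lw; rewrite lee_fin h0.
  apply: le_trans (mass_le1 RST_T); apply: le_esum => w lw.
  rewrite -EFinD lee_fin /h -(in_fset_set finF); case: ifPn => wF; last first.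
    by rewrite addr0 ler_piMr ?p0// exprn_ile1//; lra.
  by rewrite -mulrDr ler_piMr ?p0// expr_tangent_le// XK.
rewrite EFinB leeBrDr// EFinM; apply: le_trans Sgh; exact: leeD2l.
Qed.

End GeneratingFunction.

(** * The expected remaining time *)

Section RemainingTime.
Variables (R : realType) (Sg : signature) (V : Type) (P : PTRS R Sg V).
Variable (T : tree R Sg V).
Hypothesis RST_T : is_RST P T.

Lemma leafsum_fin_num (g : seq nat -> R) v :
  (forall w, leaf T w -> 0 <= g w) ->
  (\esum_(w in leaf T) (g w)%:E < +oo)%E -> leafsum T g v \is a fin_num.
Proof.
move=> g0 goo; rewrite ge0_fin_numE ?leafsum_ge0//; apply: le_lt_trans goo.
by apply: le_esum => w lw; rewrite lee_fin; case: ifP => // _; exact: g0.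
Qed.

Lemma fine_leafsum_children (g : seq nat -> R) v k :
  (forall w, leaf T w -> 0 <= g w) ->
  (\esum_(w in leaf T) (g w)%:E < +oo)%E ->
  node T v -> ~ leaf T v -> (forall i, node T (rcons v i) <-> (i < k)%N) ->
  fine (leafsum T g v) = \sum_(i < k) fine (leafsum T g (rcons v i)).
Proof.
move=> g0 goo nv lv ch; rewrite (leafsum_children RST_T nv lv ch g0) sum_fine//.
by move=> i _; exact: leafsum_fin_num.
Qed.

Definition depth_weight w := (size w)%:R * nprob T w.

(* The expected number of steps from v to a leaf, weighted by the probability
   of v; meaningful only when the mass is 1 and the sum is finite. *)
Definition remaining_time v :=
  fine (leafsum T depth_weight v) - (size v)%:R * nprob T v.

Hypothesis mass_T : (1 <= mass T)%E.
Hypothesis time_T : (\esum_(w in leaf T) (depth_weight w)%:E < +oo)%E.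

Let p0 w : leaf T w -> 0 <= nprob T w.
Proof. by move=> [/(nprob_gt0 RST_T)/ltW]. Qed.

Let w0 w : leaf T w -> 0 <= depth_weight w.
Proof. by move=> lw; rewrite mulr_ge0// p0. Qed.

(** With mass 1, the leaves below [v] carry exactly [nprob T v]. The subtracted term is thus a leaf
    sum too, with the depth of [v] in place of the depth of each leaf. *)
Lemma remaining_time_ge0 v : node T v -> 0 <= remaining_time v.
Proof.
move=> nv; rewrite subr_ge0 -lee_fin fineK ?leafsum_fin_num//.
have -> : ((size v)%:R * nprob T v)%:E =
    leafsum T (fun w => (size v)%:R * nprob T w) v.
  transitivity (\sum_(i < size v) leafsum T (nprob T) v)%E.
    by rewrite (leafsum_nprob RST_T)// sumEFin sumr_const card_ord mulr_natl.
  rewrite /leafsum -esum_sum; last first.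
    by move=> w i lw _; case: ifP => // _; rewrite lee_fin p0.
  apply: eq_esum => w lw; rewrite sumEFin sumr_const card_ord.
  by case: ifP => _; rewrite ?mulr_natl ?mul0rn.
apply: le_leafsum => w lw /size_prefix vw.
by rewrite ler_wpM2r ?p0// ler_nat.
Qed.

(** The leaf sums add up, while the children lie one level deeper than [v] and together have its
    probability. *)
Lemma remaining_time_children v k : node T v -> ~ leaf T v ->
  (forall i, node T (rcons v i) <-> (i < k)%N) ->
  \sum_(i < k) remaining_time (rcons v i) + nprob T v = remaining_time v.
Proof.
move=> nv lv ch; rewrite /remaining_time (fine_leafsum_children w0 time_T nv lv ch).
rewrite sumrB -addrA; congr (_ + _).
rewrite (eq_bigr (fun i : 'I_k => (size v).+1%:R * nprob T (rcons v i))); last first.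
  by move=> i _; rewrite size_rcons.
rewrite -mulr_sumr (sum_children RST_T nv lv ch) -natr1; ring.
Qed.

End RemainingTime.

(** * Unfolding a probabilistic transition system *)

Section Unfold.
Variables (R : realType) (Sg : signature) (V : Type) (P : PTRS R Sg V).
Variables (X : Type) (tm : X -> term Sg V) (next : X -> mdistr R X).
Variables (inv : X -> Prop) (x0 : X).
Hypothesis inv0 : inv x0.
Hypothesis next_step : forall x, inv x -> (0 < md_size (next x))%N ->
  step P (tm x) (md_map tm (next x)) /\ forall j, inv (md_val (next x) j).

(** [None] marks an address outside the tree; [p] is the probability of the path so far. A state
    halts when its [next] is empty. *)
Definition move (o : option (R * X)) (i : nat) : option (R * X) :=
  if o is Some (p, x) then
    omap (fun j => (p * md_prob (next x) j, md_val (next x) j))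
      (insub i : option 'I_(md_size (next x)))
  else None.

Definition run (v : seq nat) : option (R * X) := foldl move (Some (1, x0)) v.

Definition unfold_tree : tree R Sg V :=
  Tree [set v | isSome (run v)]
       (fun v => oapp fst 0 (run v)) (fun v => tm (oapp snd x0 (run v))).

Lemma run_rcons v (i : nat) p x (j : 'I_(md_size (next x))) : run v = Some (p, x) ->
  i = j -> run (rcons v i) = Some (p * md_prob (next x) j, md_val (next x) j).
Proof. by move=> rv ->; rewrite /run foldl_rcons -/(run v) rv /= valK. Qed.

Lemma isSome_run_rcons v i p x : run v = Some (p, x) ->
  isSome (run (rcons v i)) = (i < md_size (next x))%N.
Proof.
move=> rv; rewrite /run foldl_rcons -/(run v) rv /=.
by case: (@insubP _ _ 'I_(md_size (next x)) i) => [j ->//|/negbTE].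
Qed.

Lemma run_inv v p x : run v = Some (p, x) -> inv x /\ 0 < p <= 1.
Proof.
elim/last_ind: v p x => [|v i IH] p x; first by case=> <- <-; rewrite ltr01 lexx.
case rv : (run v) => [[q y]|]; last by rewrite /run foldl_rcons -/(run v) rv.
have [iy /andP[q0 q1]] := IH _ _ rv; move=> e.
have iy1 : (i < md_size (next y))%N by rewrite -(isSome_run_rcons i rv) e.
have [st vals] := next_step iy (leq_ltn_trans (leq0n i) iy1).
move: e; rewrite (run_rcons (j := Ordinal iy1) rv)// => -[<- <-]; split=> //.
have [/(_ (Ordinal iy1)) m0 _] := step_mdistr st.
have m1 := is_mdistr_le1 (Ordinal iy1) (step_mdistr st).
by rewrite mulr_gt0//= mulr_ile1//; exact: ltW.
Qed.

Lemma unfold_leaf v p x : run v = Some (p, x) ->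
  leaf unfold_tree v <-> md_size (next x) = 0.
Proof.
move=> rv; rewrite /leaf /= rv; split=> [[_ h]|e].
  apply/eqP; rewrite -leqn0 leqNgt; apply/negP => n0.
  by apply: (h 0); rewrite (isSome_run_rcons _ rv).
by split=> // i; rewrite (isSome_run_rcons _ rv) e.
Qed.

Lemma unfold_tree_RST : is_RST P unfold_tree.
Proof.
split=> //=.
- move=> v i; rewrite /run foldl_rcons -/(run v); by case: (run v).
- move=> v; case rv: (run v) => [[p x]|//] _ /=; exact: (run_inv rv).2.
- move=> v; case rv: (run v) => [[p x]|//] _ nl /=.
  have n0 : (0 < md_size (next x))%N.
    by rewrite lt0n; apply/eqP => /(unfold_leaf rv).
  have [iv /andP[p0 _]] := run_inv rv.
  exists (md_map tm (next x)); split=> [|i|j] /=.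
  + exact: (next_step iv n0).1.
  + by rewrite (isSome_run_rcons _ rv).
  + by rewrite (run_rcons (j := j) rv)//= mulrAC divff ?mul1r// gt_eqF.
Qed.

End Unfold.

(** * The random walk *)

Section Walk.
Variables (R : realType) (Sg : signature) (V : Type) (P : PTRS R Sg V).
Variables (t : term Sg V) (sigma : substitution Sg V) (T : tree R Sg V).
Hypothesis pattern_T : is_pattern_tree P t sigma T.
Hypothesis root_T : ~ leaf T [::].

Let RST_T := PT_RST pattern_T.

(* The current term, together with the node of T reached in the pattern tree
   being unfolded and the count of [unfolding]; [None] once the count is used
   up at the end of a pattern tree. *)
Definition state := (term Sg V * option (seq nat * nat))%type.

(** Leaves of [T] are excluded: a walk that arrives at one restarts or halts within the same
    step. *)
Definition valid (x : state) : Prop :=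
  if x.2 is Some (w, n) then
    [/\ node T w, ~ leaf T w & unfolding t sigma x.1 (nterm T w) n]
  else True.

Definition gain w := maxOPO t sigma (nterm T w).

(** A restart consumes one unit of the counter, whence [m.+1]; the inequality allows the counter to
    exceed [n + gain w]. *)
Definition moves_to w n (o : option (seq nat * nat)) : Prop :=
  match o with
  | Some (w', m) => ~ leaf T w /\ (w', m) = (w, n) \/
      [/\ leaf T w, w' = [::] & (n + gain w <= m.+1)%N]
  | None => leaf T w /\ (n + gain w = 0)%N
  end.

(** At a leaf, the counter from [unfolding_counter] decides between halting and restarting; [root_T]
    makes the root valid for a restart. *)
Lemma moves_exists s w n : node T w -> unfolding t sigma s (nterm T w) n ->
  exists o, valid (s, o) /\ moves_to w n o.
Proof.
move=> nw sw; have [lw|lw] := pselect (leaf T w); last first.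
  by exists (Some (w, n)); split; [|left].
have [l [l0 ol pl sl]] := maxOPO_family (PT_leaf pattern_T lw)
  (fun p m kappa => PT_commute pattern_T lw).
have [[|k]] := unfolding_counter sw l0 ol pl; rewrite sl => nk ck.
  by exists None; split=> //; split=> //; apply/eqP; rewrite -leqn0.
exists (Some ([::], k)); split; last by right.
split=> //; first exact: RST_root RST_T.
by rewrite (PT_root pattern_T); exact: counter_unfolding.
Qed.

Definition walk_step (x : state) (mu : mdistr R state) : Prop :=
  if x.2 is Some (w, n) then
    [/\ step P x.1 (md_map fst mu),
        forall i, node T (rcons w i) <-> (i < md_size mu)%N,
        forall j, md_prob mu j = nprob T (rcons w j) / nprob T w &
        forall j : 'I_(md_size mu), valid (md_val mu j) /\
          moves_to (rcons w j) n (md_val mu j).2]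
  else md_size mu = 0%N.

(** The existential precedes the implication so that choice gives a total function; halted and
    invalid states get the empty distribution. *)
Lemma walk_step_exists x : exists mu, valid x -> walk_step x mu.
Proof.
case: x => s [[w n]|]; last first.
  by exists (@MDistr R state 0 (fun=> 0) (fun=> (s, None))).
have [[nw lw sw]|nv] := pselect (valid (s, Some (w, n))); last first.
  by exists (@MDistr R state 0 (fun=> 0) (fun=> (s, None))).
have [mu [st ch pr]] := RST_step RST_T nw lw.
have [f stf fu] := unfolding_step sw st.
have /choice[nxt h] : forall j : 'I_(md_size mu), exists o,
    valid (f (md_val mu j), o) /\ moves_to (rcons w j) n o.
  move=> j; apply: moves_exists; first exact/ch.
  by have [_ ->] := pr j; exact: fu.
exists (@MDistr R state _ (md_prob mu) (fun j => (f (md_val mu j), nxt j))).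
move=> _; split=> // j.
by have [<- _] := pr j.
Qed.

Definition walk_next : state -> mdistr R state := projT1 (choice walk_step_exists).

Lemma walk_nextP x : valid x -> walk_step x (walk_next x).
Proof. exact: (projT2 (choice walk_step_exists)). Qed.

Definition walk_start : state := (app sigma t, Some ([::], 0%N)).

Lemma valid_start : valid walk_start.
Proof.
split=> //; first exact: RST_root RST_T.
by rewrite /= (PT_root pattern_T); exact: unfolding_self.
Qed.

Lemma walk_next_step x : valid x -> (0 < md_size (walk_next x))%N ->
  step P x.1 (md_map fst (walk_next x)) /\
  forall j, valid (md_val (walk_next x) j).
Proof.
move=> vx; have := walk_nextP vx; rewrite /walk_step.
case: x.2 => [[w n] [st _ _ h] _|e]; last by move=> e0; exfalso; rewrite e in e0.
split=> // j.
exact: (h j).1.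
Qed.

Definition walk : tree R Sg V := unfold_tree fst walk_next walk_start.

Lemma walk_RST : is_RST P walk.
Proof. exact: (unfold_tree_RST valid_start walk_next_step). Qed.

(** * The potential of the walk *)

Section Potential.
Variables (z eps : R).
Hypothesis z01 : 0 <= z <= 1.
Hypothesis eps0 : 0 <= eps.

Let genfun w := nprob T w * z ^+ gain w.

Hypothesis genfun_T : (\esum_(w in leaf T) (genfun w)%:E <= (z + eps)%:E)%E.

Let genfun0 w : leaf T w -> 0 <= genfun w.
Proof.
move=> [/(nprob_gt0 RST_T)/ltW p0 _]; rewrite mulr_ge0// exprn_ge0//.
by have /andP[] := z01.
Qed.

Let genfun_fin : (\esum_(w in leaf T) (genfun w)%:E < +oo)%E.
Proof. by apply: le_lt_trans genfun_T _; rewrite ltry. Qed.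

(** Extends z^counter to the inside of a pattern tree: [z ^+ n] times the expectation, given that
    [w] is reached, of [z ^+ gain] at the final leaf, infinite branches counting 0. [None] stands
    for counter 0. *)
Definition potential (o : option (seq nat * nat)) : R :=
  if o is Some (w, n) then z ^+ n * (fine (leafsum T genfun w) / nprob T w)
  else 1.

Lemma potential_ge0 x : valid x -> 0 <= potential x.2.
Proof.
case: x => s [[w n]|//] [nw _ _] /=; have /andP[z0 _] := z01.
rewrite mulr_ge0 ?exprn_ge0// divr_ge0 ?(ltW (nprob_gt0 RST_T nw))//.
by apply: fine_ge0; exact: leafsum_ge0.
Qed.

Lemma potential_root : potential (Some ([::], 0%N)) <= z + eps.
Proof.
rewrite /potential expr0 mul1r (RST_root_prob RST_T) divr1 leafsum_root.
by rewrite -lee_fin fineK// -leafsum_root leafsum_fin_num.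
Qed.

(** Only a restart spends [eps]: [z ^+ m * (z + eps)] is at most [z ^+ m.+1 + eps], and
    [z ^+ m.+1 <= z ^+ (n + gain w)]. *)
Lemma potential_moves w n o : node T w -> moves_to w n o ->
  nprob T w * potential o <=
    z ^+ n * fine (leafsum T genfun w) + nprob T w * eps.
Proof.
move=> nw; have p0 := nprob_gt0 RST_T nw; have /andP[z0 z1] := z01.
have pe : 0 <= nprob T w * eps by rewrite mulr_ge0// ltW.
case: o => [[w' m]|] /= [].
- move=> [lw [-> ->]]; rewrite mulrCA [_ * (_ / _)]mulrC divfK ?gt_eqF//.
  by rewrite lerDl.
- move=> [lw -> nm]; rewrite (leafsum_leaf RST_T lw) ?genfun0//= /genfun.
  rewrite [X in _ <= X + _]mulrCA -mulrDr ler_pM2l// -exprD.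
  have := potential_root; rewrite /potential expr0 mul1r => root.
  have zm : z ^+ m.+1 <= z ^+ (n + gain w) by apply: ler_wiXn2l.
  have m0 : 0 <= z ^+ m by rewrite exprn_ge0.
  have m1 : z ^+ m <= 1 by rewrite exprn_ile1.
  apply: le_trans (ler_wpM2l m0 root) _.
  by rewrite exprSr in zm; rewrite mulrDr lerD// ler_piMl.
- move=> lw nm; rewrite (leafsum_leaf RST_T lw) ?genfun0//= /genfun.
  by rewrite mulrCA -exprD nm expr0 !mulr1 lerDl.
Qed.

Lemma potential_step s w n : valid (s, Some (w, n)) ->
  \sum_j md_prob (walk_next (s, Some (w, n))) j *
      potential (md_val (walk_next (s, Some (w, n))) j).2 <=
    potential (Some (w, n)) + eps.
Proof.
set mu := walk_next _; move=> vx; have [_ ch pr h] := walk_nextP vx; have [nw lw _] := vx.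
have p0 := nprob_gt0 RST_T nw.
rewrite -(ler_pM2l p0) mulr_sumr.
apply: le_trans (_ : _ <= \sum_(j < md_size mu)
  (z ^+ n * fine (leafsum T genfun (rcons w j)) + nprob T (rcons w j) * eps)) _.
  apply: ler_sum => j _; rewrite pr mulrA mulrCA divff ?gt_eqF// mulr1.
  by apply: potential_moves; [apply/ch|exact: (h j).2].
rewrite big_split /= -mulr_sumr -mulr_suml (sum_children RST_T nw lw ch).
rewrite -(fine_leafsum_children RST_T genfun0 genfun_fin nw lw ch).
rewrite mulrDr lerD2r /potential mulrCA.
by rewrite [X in _ <= _ * X]mulrC divfK// gt_eqF.
Qed.

(* Every step raises the potential by at most eps; Q pays for this. *)
Lemma mass_walk_le (Q : seq nat -> R) :
  (forall v, node walk v -> 0 <= Q v) ->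
  (forall v k, node walk v -> ~ leaf walk v ->
    (forall i, node walk (rcons v i) <-> (i < k)%N) ->
    eps * (\sum_(i < k) Q (rcons v i) + nprob walk v) <= eps * Q v) ->
  (mass walk <= (z + eps + eps * Q [::])%:E)%E.
Proof.
move=> Q0 hQ.
(* [psi] is superharmonic and at least [nprob] at the leaves, so [leafsum_le] bounds the mass by its
   value at the root. *)
pose psi v := nprob walk v *
  potential (oapp snd walk_start (run walk_next walk_start v)).2 + eps * Q v.
have psi0 v : node walk v -> 0 <= psi v.
  move=> nv; rewrite addr_ge0 ?mulr_ge0 ?Q0//; move: nv.
    by move=> /(nprob_gt0 walk_RST)/ltW.
  rewrite /=; case rv: (run _ _ v) => [[p x]|//] _.
  exact: potential_ge0 (run_inv valid_start walk_next_step rv).1.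
apply: (@le_trans _ _ (psi [::])%:E); last first.
  rewrite lee_fin /psi /= mul1r lerD2r; exact: potential_root.
rewrite /mass -leafsum_root.
apply: (leafsum_le walk_RST) (RST_root walk_RST) => //.
- move=> v k nv lv ch; have := hQ _ _ nv lv ch; have := nv; rewrite /psi /=.
  case rv : (run walk_next _ v) => [[p [s o]]|//] _ /= hQv.
  have [vx /andP[p0 _]] := run_inv valid_start walk_next_step rv.
  have k_eq : k = md_size (walk_next (s, o)).
    have le i : (i < k)%N = (i < md_size (walk_next (s, o)))%N.
      by apply/idP/idP; rewrite -(isSome_run_rcons i rv) => /ch.
    by case: (ltngtP k (md_size (walk_next (s, o)))) => //; rewrite -?le ?ltnn// le ltnn.
  move: hQv; rewrite {}k_eq {ch k} big_split -mulr_sumr /= => hQv.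
  case: o vx lv rv hQv => [[w n] vx lv rv hQv|vx lv rv]; last first.
    by case: lv; apply/(unfold_leaf fst rv); exact: walk_nextP vx.
  have := potential_step vx; rewrite /= -(ler_pM2l p0) mulr_sumr => pot.
  rewrite [X in X + _](_ : _ = \sum_j p * (md_prob (walk_next (s, Some (w, n))) j *
      potential (md_val (walk_next (s, Some (w, n))) j).2)); last first.
    by apply: eq_bigr => j _; rewrite (run_rcons (j := j) rv)//= mulrA.
  by move: pot hQv; rewrite /=; lra.
- by move=> w [/(nprob_gt0 walk_RST)/ltW].
- move=> v lv; have nv := lv.1; rewrite /psi /=; move: (nv) => /=.
  case rv: (run walk_next _ v) => [[p [s o]]|//] _ /=.
  have [vx _] := run_inv valid_start walk_next_step rv.
  have e : md_size (walk_next (s, o)) = 0%N by apply/(unfold_leaf fst rv).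
  (* At a leaf of the walk the state is [None], of potential 1: a valid [Some] state sits at an
     inner node of [T] and inherits its children. *)
  case: o vx e rv => [[w n] vx e rv|_ _ _] /=; last first.
    by rewrite mulr1 lerDl mulr_ge0// Q0.
  have [_ ch _ _] := walk_nextP vx; have [nw lw _] := vx.
  by case: lw; split=> // i /ch; rewrite e.
Qed.

End Potential.
End Walk.

(** * From the walk to the failure of AST and PAST *)

Lemma height_gt0 (R : realType) (Sg : signature) (V : Type) (P : PTRS R Sg V)
    (T : tree R Sg V) :
  is_RST P T -> (0%:E < height T)%E -> ~ leaf T [::].
Proof.
move=> RST_T /ereal_sup_gt[_ [v nv <-]] + [_ no_child].
case: v nv => [|i v] nv; first by rewrite lte_fin ltxx.
by case: (no_child i); exact: (node_catl (w := v) RST_T).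
Qed.

(** With [d * (1 + B)] equal to 1/2, the bound becomes [z + (1 - z) / 2]. One [d] must serve all
    [z], because [z] is later chosen depending on [d]. *)
Lemma small_slope (R : realType) (B : R) : 0 <= B -> exists d : R,
  [/\ 0 < d, d < 1 &
    forall z, z < 1 -> z + (1 - z) * d + (1 - z) * d * B < 1].
Proof.
move=> B0; have B1 : 0 < 2 * (1 + B) by lra.
exists (2 * (1 + B))^-1; set d := _^-1.
have dB : d * (2 * (1 + B)) = 1 by rewrite mulVf// gt_eqF.
have d0 : 0 < d by rewrite invr_gt0.
by split=> //; [nra|move=> z z1; nra].
Qed.

Theorem theorem27 (R : realType) (Sg : signature) (V : Type)
    (P : PTRS R Sg V) (t : term Sg V) (sigma : substitution Sg V)
    (T : tree R Sg V)
    (pattern_t : pattern_term t sigma)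
    (pattern_T : is_pattern_tree P t sigma T)
    (height_T : (0%:E < height T)%E) :
  ((1%:E < \esum_(v in leaf T)
      (nprob T v * (maxOPO t sigma (nterm T v))%:R)%:E)%E -> ~ AST P) /\
  ((1%:E <= \esum_(v in leaf T)
      (nprob T v * (maxOPO t sigma (nterm T v))%:R)%:E)%E -> ~ PAST P).
Proof.
have root_T := height_gt0 (PT_RST pattern_T) height_T.
have walkP := walk_RST pattern_T root_T.
split=> [gt1 ast|ge1 past].
  (* With [c = 1] the bound is [z] itself, so [eps] and [Q] are taken to be 0. *)
  have [z [z0 z1 le_z]] := generating_function_le (X := gain t sigma T)
    (PT_RST pattern_T) ler01 gt1.
  rewrite mulr1 subKr -[X in X%:E]addr0 in le_z.
  have z01 : 0 <= z <= 1 by rewrite !ltW.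
  have : (mass (walk pattern_T root_T) <= (z + 0 + 0 * 0)%:E)%E.
    apply: (mass_walk_le z01 (lexx 0) le_z (Q := fun=> 0)) => // v k _ _ _.
    by rewrite !mul0r.
  by rewrite (ast _ walkP) mul0r !addr0 lee_fin leNgt z1.
set W := walk _ _ in walkP.
have := past _ walkP; rewrite /edl; case: (ltP (mass W)) => // mass_ge1 time_fin.
(* The expected derivation length of the walk. The walk does not depend on [z], so [B] can determine
   [d] before [z] is known. *)
pose B := remaining_time W [::].
have B0 : 0 <= B.
  exact: (remaining_time_ge0 walkP mass_ge1 time_fin (RST_root walkP)).
have [d [d0 d1 small]] := small_slope B0.
(* Lowering the threshold to [1 - d] gives the strict inequality that [generating_function_le]
   requires. *)
have lt1 : ((1 - d)%:E < \esum_(v in leaf T)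
    (nprob T v * (maxOPO t sigma (nterm T v))%:R)%:E)%E.
  by apply: lt_le_trans ge1; rewrite lte_fin ltrBlDr ltrDl.
have c0 : 0 <= 1 - d by rewrite subr_ge0 ltW.
have [z [z0 z1 le_z]] := generating_function_le (X := gain t sigma T)
  (PT_RST pattern_T) c0 lt1.
have eps0 : 0 <= (1 - z) * d by rewrite mulr_ge0 ?subr_ge0// ltW.
have e : 1 - (1 - z) * (1 - d) = z + (1 - z) * d by ring.
rewrite {}e in le_z.
have z01 : 0 <= z <= 1 by rewrite !ltW.
suff mass_le : (mass W <= (z + (1 - z) * d + (1 - z) * d * B)%:E)%E.
  by have := le_trans mass_ge1 mass_le; rewrite lee_fin leNgt small.
(* [Q] is the remaining time, which pays for each step exactly. *)
apply: (mass_walk_le z01 eps0 le_z); first exact: (remaining_time_ge0 walkP).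
by move=> v k nv lv ch; rewrite (remaining_time_children walkP time_fin nv lv ch).
Qed.
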